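(* Every output $(Q,c)$ of Algorithm 4 (described in the context) satisfies $(Q,c)\in\mathcal{E}_{RS}\setminus\mathcal{E}_R$.
   Context: Let $n \ge 1$, let $\mathcal{S}^n$ be the space of real symmetric $n\times n$ matrices, $e \in \mathbb{R}^n$ the all-ones vector, $\langle A,B\rangle = \mathrm{trace}(A^TB)$; inequalities $\ge,\le$ on vectors and matrices are componentwise, and $A\succeq0$ (resp. $A\succ0$) means positive semidefinite (resp. positive definite). For index sets $\mathbb{J},\mathbb{K}$, $x_{\mathbb{K}}$ is the subvector of $x$ indexed by $\mathbb{K}$ and $B_{\mathbb{J}\mathbb{K}}$ (or $B_{\mathbb{J},\mathbb{K}}$) the submatrix of $B$ with rows in $\mathbb{J}$ and columns in $\mathbb{K}$. For $(Q,c) \in \mathcal{S}^n\times\mathbb{R}^n$ let $q(x) = \frac12 x^TQx + c^Tx$, $F = \{x \in \mathbb{R}^n : 0 \le x \le e\}$, $V=\{0,1\}^n$ (the vertices of $F$), $\ell^* = \min_{x\in F} q(x)$ (the problem (BoxQP)). Let $$\mathcal{F}_R = \{(x,X)\in\mathbb{R}^n\times\mathcal{S}^n : 0\le x\le e,\ \max\{x_i+x_j-1,0\}\le X_{ij}\le \min\{x_i,x_j\},\ 1\le i\le j\le n\},$$ $\mathcal{F}_{RS} = \{(x,X)\in\mathcal{F}_R : X-xx^T\succeq0\}$, $\ell^*_R=\min\{\frac12\langle Q,X\rangle+c^Tx : (x,X)\in\mathcal{F}_R\}$ (RLT relaxation), $\ell^*_{RS}=\min\{\frac12\langle Q,X\rangle+c^Tx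 : (x,X)\in\mathcal{F}_{RS}\}$ (SDP-RLT relaxation), $\mathcal{E}_R=\{(Q,c)\in\mathcal{S}^n\times\mathbb{R}^n:\ell^*=\ell^*_R\}$ and $\mathcal{E}_{RS}=\{(Q,c)\in\mathcal{S}^n\times\mathbb{R}^n : \ell^*=\ell^*_{RS}\}$. Algorithm 4. Input: $n$ and $\hat x\in F\setminus V$. Set $\mathbb{L}=\{j:\hat x_j=0\}$, $\mathbb{B}=\{j:0<\hat x_j<1\}$, $\mathbb{U}=\{j:\hat x_j=1\}$. Choose arbitrary: $\hat u\in\mathbb{R}^n$ with $\hat u_{\mathbb{U}}\ge0$, $\hat u_{\mathbb{L}\cup\mathbb{B}}=0$; $\hat v\in\mathbb{R}^n$ with $\hat v_{\mathbb{L}}\ge0$, $\hat v_{\mathbb{B}\cup\mathbb{U}}=0$; $\hat W\in\mathcal{S}^n$ with $\hat W_{\mathbb{B}\cup\mathbb{L},\mathbb{B}\cup\mathbb{L}}=0$ and $\hat W_{ij}\ge0$ otherwise; $\hat Y\in\mathbb{R}^{n\times n}$ with $\hat Y_{\mathbb{L}\mathbb{B}}=0$, $\hat Y_{\mathbb{L}\mathbb{U}}=0$, $\hat Y_{\mathbb{B}\mathbb{B}}=0$, $\hat Y_{\mathbb{B}\mathbb{U}}=0$ and $\hat Y_{ij}\ge0$ otherwise; $\hat Z\in\mathcal{S}^n$ with $\hat Z_{\mathbb{B}\cup\mathbb{U},\mathbb{B}\cup\mathbb{U}}=0$ and $\hat Z_{ij}\ge0$ otherwise; $\hat H\in\mathcal{S}^n$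 with $\hat H\succ0$. Set $\hat h=-\hat H\hat x$, $\hat\beta=-\hat h^T\hat x$. Output $(Q,c)$ with $Q=\hat W-\hat Y-\hat Y^T+\hat Z+\hat H$ and $c=-\hat u+\hat v-\hat We+\hat Y^Te+\hat h$. *)

(* Defs.v *)
From HB Require Import structures.
From mathcomp Require Import all_boot all_order all_algebra.
From mathcomp Require Import all_classical all_reals all_analysis.
Import Order.TTheory GRing.Theory Num.Theory.
Import numFieldNormedType.Exports.

Set Implicit Arguments.
Unset Strict Implicit.
Unset Printing Implicit Defensive.

Local Open Scope classical_set_scope.
Local Open Scope ring_scope.

Definition possemidefmx (R : realType) (n : nat) (A : 'M[R]_n) : Prop :=
  forall z : 'cV[R]_n, 0 <= (z^T *m A *m z) 0 0.

Definition posdefmx (R : realType) (n : nat) (A : 'M[R]_n) : Prop :=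
  forall z : 'cV[R]_n, z != 0 -> 0 < (z^T *m A *m z) 0 0.

Definition mxinner (R : realType) (n : nat) (A B : 'M[R]_n) : R :=
  \tr (A^T *m B).

Definition ones (R : realType) (n : nat) : 'cV[R]_n := const_mx 1.

(* [xget] returns the element of [A `&` lbound A], which is unique when it
   exists, and the junk value 0 when [A] has no minimum. The minima below all
   exist: see [boxqp_min_attained], [rlt_min_attained] and
   [sdprlt_min_attained]. *)
Definition min_of (R : realType) (A : set R) : R := xget 0 (A `&` lbound A).

Definition box (R : realType) (n : nat) : set 'cV[R]_n :=
  [set x | forall i, 0 <= x i 0 <= 1].

Definition vertices (R : realType) (n : nat) : set 'cV[R]_n :=
  [set x | forall i, x i 0 = 0 \/ x i 0 = 1].

Definition boxqp_obj (R : realType) (n : nat) (Q : 'M[R]_n) (c x : 'cV[R]_n)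
    : R :=
  2^-1 * (x^T *m Q *m x) 0 0 + (c^T *m x) 0 0.

Definition lifted_obj (R : realType) (n : nat) (Q : 'M[R]_n) (c : 'cV[R]_n)
    (xX : 'cV[R]_n * 'M[R]_n) : R :=
  2^-1 * mxinner Q xX.2 + (c^T *m xX.1) 0 0.

Definition rlt_feasible (R : realType) (n : nat)
    : set ('cV[R]_n * 'M[R]_n) :=
  [set xX | [/\ xX.2 \is symmetricmx, box xX.1
    & forall i j : 'I_n, (i <= j)%N ->
        Num.max (xX.1 i 0 + xX.1 j 0 - 1) 0 <= xX.2 i j
          <= Num.min (xX.1 i 0) (xX.1 j 0)]].

Definition sdprlt_feasible (R : realType) (n : nat)
    : set ('cV[R]_n * 'M[R]_n) :=
  [set xX | rlt_feasible xX /\ possemidefmx (xX.2 - xX.1 *m xX.1^T)].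

Definition boxqp_min (R : realType) (n : nat) (Q : 'M[R]_n) (c : 'cV[R]_n)
    : R :=
  min_of (boxqp_obj Q c @` @box R n).

Definition rlt_min (R : realType) (n : nat) (Q : 'M[R]_n) (c : 'cV[R]_n) : R :=
  min_of (lifted_obj Q c @` @rlt_feasible R n).

Definition sdprlt_min (R : realType) (n : nat) (Q : 'M[R]_n) (c : 'cV[R]_n)
    : R :=
  min_of (lifted_obj Q c @` @sdprlt_feasible R n).

Definition exact_rlt (R : realType) (n : nat) : set ('M[R]_n * 'cV[R]_n) :=
  [set Qc | Qc.1 \is symmetricmx /\ boxqp_min Qc.1 Qc.2 = rlt_min Qc.1 Qc.2].

Definition exact_sdprlt (R : realType) (n : nat) : set ('M[R]_n * 'cV[R]_n) :=
  [set Qc | Qc.1 \is symmetricmx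
            /\ boxqp_min Qc.1 Qc.2 = sdprlt_min Qc.1 Qc.2].

Definition idxL (R : realType) (n : nat) (x : 'cV[R]_n) : {set 'I_n} :=
  [set j | x j 0 == 0]%SET.

Definition idxB (R : realType) (n : nat) (x : 'cV[R]_n) : {set 'I_n} :=
  [set j | 0 < x j 0 < 1]%SET.

Definition idxU (R : realType) (n : nat) (x : 'cV[R]_n) : {set 'I_n} :=
  [set j | x j 0 == 1]%SET.

Definition zero_on_nneg_off (R : realType) (n : nat)
    (D : {set 'I_n * 'I_n}) (A : 'M[R]_n) : Prop :=
  forall i j, ((i, j) \in D -> A i j = 0) /\ ((i, j) \notin D -> 0 <= A i j).

(* The multiplier beta = - h^T xhat computed by the algorithm is left out, as
   it does not enter the output (Q, c). *)
Definition algorithm4_output (R : realType) (n : nat) (xhat : 'cV[R]_n)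
    (Q : 'M[R]_n) (c : 'cV[R]_n) : Prop :=
  let L := idxL xhat in let B := idxB xhat in let U := idxU xhat in
  let e := ones R n in
  exists (u v : 'cV[R]_n) (W Y Z H : 'M[R]_n),
    let h := - (H *m xhat) in
    [/\ forall i, (i \in U -> 0 <= u i 0) /\ (i \in (L :|: B)%SET -> u i 0 = 0),
        forall i, (i \in L -> 0 <= v i 0) /\ (i \in (B :|: U)%SET -> v i 0 = 0),
        W \is symmetricmx /\
          zero_on_nneg_off (finset.setX (B :|: L) (B :|: L)) W,
        zero_on_nneg_off
          (finset.setX L B :|: finset.setX L U
             :|: finset.setX B B :|: finset.setX B U) Y
      & Z \is symmetricmx /\
          zero_on_nneg_off (finset.setX (B :|: U) (B :|: U)) Z]
    /\ [/\ H \is symmetricmx, posdefmx H,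
        Q = W - Y - Y^T + Z + H
      & c = - u + v - W *m e + Y^T *m e + h].

Section min_attained.
Variables (R : realType).

Lemma min_of_attained (N : nat) (T : Type) (S : set T) (f : T -> R)
    (p : 'rV[R]_N -> T) (g : T -> 'rV[R]_N) :
  cancel g p -> S !=set0 -> continuous (f \o p) -> closed (p @^-1` S) ->
  (forall u k, S (p u) -> 0 <= u 0 k <= 1) ->
  ((f @` S) `&` lbound (f @` S)) (min_of (f @` S)).
Proof.
move=> gK [t0 St0] cf cS Sb.
have cK : compact (p @^-1` S).
  apply: (subclosed_compact cS
    (@rV_compact R N (fun=> `[0, 1]%classic) (fun=> @segment_compact R 0 1))).
  by move=> u Su k /=; rewrite in_itv /= Sb.
have K0 : (p @^-1` S) !=set0 by exists (g t0); rewrite /= gK.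
have [u uK umin] := EVT_min_rV K0 cK (continuous_subspaceT cf).
rewrite /min_of; apply: (@xgetPex _ 0).
exists (f (p u)); split; first by exists (p u) => //; exact/set_mem.
move=> _ [t St <-]; rewrite -[t]gK; apply: umin.
by apply/mem_set; rewrite /= gK.
Qed.

Section continuity.
Variables (T : topologicalType).

Definition mxcont m n (F : T -> 'M[R]_(m, n)) :=
  forall i j, continuous (fun u => F u i j).

Lemma continuous_sumR (I : Type) (r : seq I) (P : pred I) (F : I -> T -> R) :
  (forall i, P i -> continuous (F i)) ->
  continuous (fun x => \sum_(i <- r | P i) F i x).
Proof. by apply: continuous_big; exact: add_continuous. Qed.

Lemma continuous_affine (a : R) (f g : T -> R) :
  continuous f -> continuous g -> continuous (fun u => a * f u + g u).
Proof.
move=> cf cg u; apply: cvgD; last exact: cg.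
by apply: cvgM; [exact: cvg_cst | exact: cf].
Qed.

Lemma mxcont_cst m n (A : 'M[R]_(m, n)) : mxcont (fun=> A).
Proof. by move=> i j; exact: cst_continuous. Qed.

Lemma mxcont_mul m n q (F : T -> 'M[R]_(m, n)) (G : T -> 'M[R]_(n, q)) :
  mxcont F -> mxcont G -> mxcont (fun u => F u *m G u).
Proof.
move=> cF cG i j.
rewrite (_ : (fun _ => _) = fun u => \sum_k (F u i k * G u k j)); last first.
  by apply/funext => u; rewrite mxE.
apply: continuous_sumR => k _ u.
apply: (@continuousM R T (fun u => F u i k) (fun u => G u k j)).
  exact: cF.
exact: cG.
Qed.

Lemma mxcont_tr m n (F : T -> 'M[R]_(m, n)) :
  mxcont F -> mxcont (fun u => (F u)^T).
Proof.
move=> cF i j; rewrite (_ : (fun _ => _) = fun u => F u j i) //.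
by apply/funext => u; rewrite mxE.
Qed.

Lemma mxcont_sub m n (F G : T -> 'M[R]_(m, n)) :
  mxcont F -> mxcont G -> mxcont (fun u => F u - G u).
Proof.
move=> cF cG i j; rewrite (_ : (fun _ => _) = fun u => F u i j - G u i j).
  by move=> u; apply: cvgB; [exact: cF | exact: cG].
by apply/funext => u; rewrite !mxE.
Qed.

Lemma closed_le_fun (f g : T -> R) :
  continuous f -> continuous g -> closed [set u | f u <= g u].
Proof.
move=> cf cg.
rewrite (_ : [set _ | _] = (fun u => g u - f u) @^-1` [set y | 0 <= y]).
  apply: preimage_closed; last exact: closed_ge.
  by move=> u _; apply: cvgB; [exact: cg | exact: cf].
by apply/seteqP; split=> u /=; rewrite subr_ge0.
Qed.

Lemma closed_eq_fun (f g : T -> R) :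
  continuous f -> continuous g -> closed [set u | f u = g u].
Proof.
move=> cf cg.
rewrite (_ : [set _ | _] = [set u | f u <= g u] `&` [set u | g u <= f u]).
  by apply: closedI; exact: closed_le_fun.
apply/seteqP; split=> u /=; first by move=> ->.
by case=> *; apply/eqP; rewrite eq_le; apply/andP.
Qed.

Lemma closed_forall (I : Type) (P : I -> T -> Prop) :
  (forall i, closed [set u | P i u]) -> closed [set u | forall i, P i u].
Proof.
move=> cP; rewrite (_ : [set _ | _] = \bigcap_i [set u | P i u]).
  by apply: closed_bigI.
by apply/seteqP; split=> u /= h i; [move=> _; exact: h | exact: (h i Logic.I)].
Qed.

Lemma closed_implyb (b : bool) (P : T -> Prop) :
  closed [set u | P u] -> closed [set u | b -> P u].
Proof.
case: b => cP.
  rewrite (_ : [set _ | _] = [set u | P u]) //.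
  by apply/seteqP; split=> u /=; [exact | move=> ? _].
rewrite (_ : [set _ | _] = setT); first exact: closedT.
by apply/seteqP; split.
Qed.

End continuity.

Variable n : nat.
Implicit Types (Q : 'M[R]_n) (c : 'cV[R]_n).

Lemma symmetricmxP (A : 'M[R]_n) :
  reflect (forall i j, A i j = A j i) (A \is symmetricmx).
Proof.
rewrite is_hermitianmxE expr0 scale1r.
apply: (iffP eqP) => [AE i j|AE]; first by rewrite {1}AE !mxE.
by apply/matrixP => i j; rewrite !mxE AE.
Qed.

Lemma boxqp_min_attained Q c :
  ((boxqp_obj Q c @` @box R n) `&` lbound (boxqp_obj Q c @` @box R n))
    (boxqp_min Q c).
Proof.
have ctr : mxcont (fun u : 'rV[R]_n => u^T).
  by apply: mxcont_tr => i j; exact: coord_continuous.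
apply: (min_of_attained (p := trmx) (g := trmx)) => //.
- by move=> x; rewrite trmxK.
- by exists 0 => i; rewrite mxE lexx ler01.
- have cl : mxcont (fun u : 'rV[R]_n => c^T *m u^T).
    by apply: mxcont_mul => //; exact: mxcont_cst.
  have cq : mxcont (fun u : 'rV[R]_n => u^T^T *m Q *m u^T).
    apply: mxcont_mul => //; apply: mxcont_mul; last exact: mxcont_cst.
    exact: mxcont_tr.
  exact: continuous_affine (cq 0 0) (cl 0 0).
- rewrite (_ : _ @^-1` _ = [set u : 'rV[R]_n | forall i, 0 <= u^T i 0]
                           `&` [set u | forall i, u^T i 0 <= 1]).
    by apply: closedI; apply: closed_forall => i; apply: closed_le_fun => //;
      exact: cst_continuous.
  apply/seteqP; split=> u /=; last by move=> [u0 u1] i; rewrite u0 u1.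
  by move=> bu; split=> i; have /andP[] := bu i.
- by move=> u k /(_ k); rewrite mxE.
Qed.

Let dec (u : 'rV[R]_(n + n * n)) : 'cV[R]_n * 'M[R]_n :=
  ((lsubmx u)^T, vec_mx (rsubmx u)).
Let enc (xX : 'cV[R]_n * 'M[R]_n) : 'rV[R]_(n + n * n) :=
  row_mx xX.1^T (mxvec xX.2).

Let encK : cancel enc dec.
Proof.
by case=> x X; rewrite /dec /enc /= row_mxKl row_mxKr trmxK mxvecK.
Qed.

Let dec1 : mxcont (fun u => (dec u).1).
Proof.
move=> i j; rewrite (_ : (fun _ => _) = fun u : 'rV[R]_(n + n * n) => u j (lshift _ i)).
  exact: coord_continuous.
by apply/funext => u; rewrite !mxE.
Qed.

Let dec2 : mxcont (fun u => (dec u).2).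
Proof.
move=> i j.
rewrite (_ : (fun _ => _) = fun u : 'rV[R]_(n + n * n) => u 0 (rshift _ (mxvec_index i j))).
  exact: coord_continuous.
by apply/funext => u; rewrite !mxE.
Qed.

Let lifted_obj_cont Q c : continuous (lifted_obj Q c \o dec).
Proof.
have cl : mxcont (fun u => c^T *m (dec u).1).
  by apply: mxcont_mul => //; exact: mxcont_cst.
have cq : mxcont (fun u => Q^T *m (dec u).2).
  by apply: mxcont_mul => //; exact: mxcont_cst.
apply: continuous_affine (cl 0 0).
by apply: continuous_sumR => i _; exact: cq.
Qed.

Let rlt_closed : closed (dec @^-1` @rlt_feasible R n).
Proof.
rewrite (_ : _ @^-1` _ =
    [set u | forall i j, (dec u).2 i j = (dec u).2 j i] `&`
    ([set u | forall i, 0 <= (dec u).1 i 0] `&`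
     [set u | forall i, (dec u).1 i 0 <= 1]) `&`
    ([set u | forall i j : 'I_n, (i <= j)%N ->
       (dec u).1 i 0 + (dec u).1 j 0 - 1 <= (dec u).2 i j] `&`
     [set u | forall i j : 'I_n, (i <= j)%N -> 0 <= (dec u).2 i j] `&`
     [set u | forall i j : 'I_n, (i <= j)%N ->
       (dec u).2 i j <= (dec u).1 i 0] `&`
     [set u | forall i j : 'I_n, (i <= j)%N ->
       (dec u).2 i j <= (dec u).1 j 0])); last first.
  apply/seteqP; split=> u.
    case=> /symmetricmxP sX bx hX; split; first split => //.
      by split=> i; have /andP[] := bx i.
    by split; first split; first split; move=> i j ij;
      have := hX i j ij; rewrite ge_max le_min => /andP[/andP[? ?] /andP[? ?]].
  case=> -[sX [x0 x1]] [[[h1 h2] h3] h4]; split; first exact/symmetricmxP.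
    by move=> i; rewrite x0 x1.
  by move=> i j ij; rewrite ge_max le_min h1 // h2 // h3 // h4.
have c0 (a : R) : continuous (fun _ : 'rV[R]_(n + n * n) => a).
  exact: cst_continuous.
do ?apply: closedI; do ?[apply: closed_forall => i; apply: closed_forall => j | apply: closed_forall => i];
  do ?apply: closed_implyb; (apply: closed_eq_fun || apply: closed_le_fun);
  do ?[exact: c0 | exact: dec1 | exact: dec2].
rewrite (_ : (fun _ => _) = fun u => 1 * (dec u).1 i 0 + (1 * (dec u).1 j 0 + - 1)).
  by do 2!apply: continuous_affine => //.
by apply/funext => u; rewrite !mul1r addrA.
Qed.

Let rlt_bounded u k : rlt_feasible (dec u) -> 0 <= u 0 k <= 1.
Proof.
case=> /symmetricmxP sX bx hX.
have X01 (i j : 'I_n) : (i <= j)%N -> 0 <= (dec u).2 i j <= 1.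
  move=> /(hX i j); rewrite ge_max le_min => /andP[/andP[_ ->] /andP[Xi _]].
  by rewrite (le_trans Xi) //; have /andP[] := bx i.
case: (splitP k) => [i ki|m km].
  by have := bx i; rewrite !mxE (_ : lshift _ i = k) //; exact: val_inj.
have -> : k = rshift n m by exact: val_inj.
case/mxvec_indexP: m {km} => i j.
rewrite (_ : u 0 _ = (dec u).2 i j); last by rewrite !mxE.
by case: (leqP i j) => [/X01 //|/ltnW/X01]; rewrite sX.
Qed.

Let rlt0 : @rlt_feasible R n (0, 0).
Proof.
split=> /= [|i|i j _]; first by apply/symmetricmxP => i j; rewrite !mxE.
  by rewrite mxE lexx ler01.
by rewrite !mxE ge_max le_min lexx addr0 sub0r lerN10.
Qed.

Lemma rlt_min_attained Q c :
  ((lifted_obj Q c @` @rlt_feasible R n)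
     `&` lbound (lifted_obj Q c @` @rlt_feasible R n)) (rlt_min Q c).
Proof.
apply: (min_of_attained (p := dec) (g := enc)) => //.
by exists (0, 0).
Qed.

Lemma sdprlt_min_attained Q c :
  ((lifted_obj Q c @` @sdprlt_feasible R n)
     `&` lbound (lifted_obj Q c @` @sdprlt_feasible R n)) (sdprlt_min Q c).
Proof.
apply: (min_of_attained (p := dec) (g := enc)) => //.
- exists (0, 0); split=> //= z.
  by rewrite mul0mx subr0 mulmx0 mul0mx mxE.
- rewrite (_ : _ @^-1` _ = dec @^-1` @rlt_feasible R n `&`
    [set u | possemidefmx ((dec u).2 - (dec u).1 *m (dec u).1^T)]) //.
  apply: closedI => //; apply: closed_forall => z; apply: closed_le_fun.
    exact: cst_continuous.
  apply: mxcont_mul; last exact: mxcont_cst.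
  apply: mxcont_mul; first exact: mxcont_cst.
  by apply: mxcont_sub => //; apply: mxcont_mul => //; exact: mxcont_tr.
- by move=> u k [/rlt_bounded].
Qed.

End min_attained.

(* Main.v *)
Require Import Defs.
From HB Require Import structures.
From mathcomp Require Import all_boot all_order all_algebra.
From mathcomp Require Import all_classical all_reals all_analysis.
Import Order.TTheory GRing.Theory Num.Theory.
Import numFieldNormedType.Exports.
From mathcomp Require Import ring lra.

Set Implicit Arguments.
Unset Strict Implicit.
Unset Printing Implicit Defensive.

Local Open Scope classical_set_scope.
Local Open Scope ring_scope.

(** The algorithm builds [(Q, c)] backwards from a KKT certificate: [u], [v],
  [W], [Y], [Z] are multipliers of the linear inequalities of the relaxation
  and [H] is the multiplier of [X - x x^T >= 0]. Substituting the formulas for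
  [Q] and [c], the relaxed objective at any [(x, X)] with [X] symmetric becomes
  a constant plus
    [1/2 sum W_ij (1 - x_i - x_j + X_ij) + sum Y_ij (x_j - X_ij)]
    [+ 1/2 sum Z_ij X_ij + sum u_i (1 - x_i) + sum v_i x_i]
    [+ 1/2 <H, (X - x x^T) + (x - xhat) (x - xhat)^T>]
  ([lifted_obj_dual_gap]). On the SDP-RLT feasible set every summand is
  nonnegative ([dual_gap_ge0]): the first five by the linear constraints, the
  last one because the inner product of two positive semidefinite matrices is
  nonnegative ([mxinner_ge0]). At [(xhat, xhat xhat^T)] they all vanish, since
  the zero patterns prescribed by the algorithm are exactly complementary
  slackness ([dual_gap_eq0]). As [x |-> (x, x x^T)] embeds the box in the
  SDP-RLT feasible set and preserves objective values, the constant is the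
  minimum of both problems, hence [(Q, c)] is SDP-RLT exact.

  It is not RLT exact because [xhat] has a fractional coordinate [k]. There the
  RLT constraints leave room below [X_kk = xhat_k^2], while the zero patterns
  force [Q_kk = H_kk > 0]; decreasing [X_kk] alone thus stays RLT feasible
  ([rlt_feasible_lower_diag]) and goes strictly below the common minimum. *)

(** * Positive semidefinite matrices *)

Lemma mxinnerE (R : realType) (n : nat) (A B : 'M[R]_n) :
  mxinner A B = \sum_i \sum_j A i j * B i j.
Proof.
rewrite exchange_big; apply: eq_bigr => j _; rewrite mxE.
by apply: eq_bigr => i _; rewrite mxE.
Qed.

Lemma symmetric_trmx (R : realType) (n : nat) (A : 'M[R]_n) :
  A \is symmetricmx -> A^T = A.
Proof. by move=> /symmetricmxP sA; apply/matrixP => i j; rewrite mxE sA. Qed.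

(** Induction on the size: split off the first row and column. The top left
  entry [a] is positive, and the Schur complement [D - b b^T / a] is again
  positive definite, so it has a factor [G] that completes the first column
  [(sqrt a, b / sqrt a)]. *)
Lemma cholesky (R : realType) (n : nat) (H : 'M[R]_n) :
  H^T = H -> posdefmx H -> exists G : 'M[R]_n, H = G *m G^T.
Proof.
elim: n H => [|n IHn] H sH pH; first by exists 0; apply/matrixP => -[].
pose a := ulsubmx (H : 'M[R]_(1 + n)) 0 0.
pose b := dlsubmx (H : 'M[R]_(1 + n)).
pose D := drsubmx (H : 'M[R]_(1 + n)).
have HE : H = block_mx a%:M b^T b D :> 'M[R]_(1 + n).
  by rewrite -mx11_scalar trmx_dlsub sH submxK.
have {}pH (z : 'cV[R]_(1 + n)) : z != 0 ->
    0 < (z^T *m block_mx a%:M b^T b D *m z) 0 0.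
  by move=> z0; rewrite -HE; exact: pH.
have a_gt0 : 0 < a.
  have z0 : col_mx 1%:M 0 != 0 :> 'cV[R]_(1 + n).
    by rewrite col_mx_eq0 negb_and; apply/orP; left; exact: oner_neq0.
  have := pH _ z0; rewrite tr_col_mx trmx0 tr_scalar_mx mul_row_block.
  by rewrite mul_row_col !mul1mx !mul0mx !mulmx0 !addr0 mulmx1 mxE eqxx mulr1n.
have sD : D^T = D by rewrite trmx_drsub sH.
pose s := Num.sqrt a.
have s2 : s * s = a by rewrite -expr2 sqr_sqrtr // ltW.
have s_neq0 : s != 0 by rewrite gt_eqF // sqrtr_gt0.
have [|z z0|G GE] := IHn (D - a^-1 *: (b *m b^T)).
- by rewrite linearB /= linearZ /= trmx_mul trmxK sD.
- (* completing the square: the first coordinate minimizes the quadratic form *)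
  pose t := - a^-1 *: (b^T *m z).
  have tz0 : col_mx t z != 0 :> 'cV[R]_(1 + n).
    by rewrite col_mx_eq0 negb_and z0 orbT.
  have := pH _ tz0; rewrite tr_col_mx mul_row_block mul_row_col.
  have -> : t^T *m a%:M + z^T *m b = 0.
    rewrite mul_mx_scalar /t linearZ /= trmx_mul trmxK scalerA mulrN divff.
      by rewrite scaleN1r addNr.
    exact: lt0r_neq0.
  rewrite mul0mx add0r mulmxDl /t linearZ /= trmx_mul trmxK.
  rewrite mulmxBr mulmxBl -!scalemxAl -scalemxAr -scalemxAl !mulmxA.
  by rewrite scaleNr addrC.
pose F : 'M[R]_(1 + n) := block_mx s%:M 0 (s^-1 *: b) G.
suff FE : block_mx a%:M b^T b D = F *m F^T by exists F; rewrite HE FE.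
rewrite tr_block_mx mulmx_block tr_scalar_mx trmx0 linearZ /=.
rewrite !mul0mx !mulmx0 !addr0 -GE -scalar_mxM s2.
rewrite mul_scalar_mx mul_mx_scalar !scalerA divff // !scale1r.
rewrite -scalemxAl -scalemxAr scalerA -invfM s2.
by rewrite addrC subrK.
Qed.

(** With [H = G G^T], the inner product is the trace of [G^T S G], whose
  diagonal entries are values of the quadratic form of [S] at the columns of
  [G]. *)
Lemma mxinner_ge0 (R : realType) (n : nat) (H S : 'M[R]_n) :
  H^T = H -> posdefmx H -> possemidefmx S -> 0 <= mxinner H S.
Proof.
move=> sH pH pS; have [G HE] := cholesky sH pH.
rewrite /mxinner sH HE -mulmxA mxtrace_mulC; apply: sumr_ge0 => i _.
have := pS (col i G); rewrite tr_col -row_mul => /le_trans; apply.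
by rewrite !mxE; apply: ler_sum => k _; rewrite !mxE.
Qed.

Lemma possemidefmx_gram (R : realType) (n : nat) (d : 'cV[R]_n) :
  possemidefmx (d *m d^T).
Proof.
move=> z; rewrite mulmxA -mulmxA mxE big_ord1.
have -> : (d^T *m z) 0 0 = (z^T *m d) 0 0.
  by rewrite -[z^T *m d]trmxK trmx_mul trmxK [RHS]mxE.
by rewrite -expr2 sqr_ge0.
Qed.

Lemma possemidefmxD (R : realType) (n : nat) (A B : 'M[R]_n) :
  possemidefmx A -> possemidefmx B -> possemidefmx (A + B).
Proof.
by move=> pA pB z; rewrite mulmxDr mulmxDl mxE addr_ge0.
Qed.

Lemma posdefmx_diag_gt0 (R : realType) (n : nat) (H : 'M[R]_n) (k : 'I_n) :
  posdefmx H -> 0 < H k k.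
Proof.
move=> pH; have k0 : delta_mx k 0 != 0 :> 'cV[R]_n.
  by apply/cV0Pn; exists k; rewrite mxE !eqxx oner_neq0.
by have := pH _ k0; rewrite trmx_delta -rowE -colE !mxE.
Qed.

(** * The feasible sets *)

(** Symmetry of [X] removes the restriction [i <= j] of the definition. *)
Lemma rlt_feasible_bounds (R : realType) (n : nat) (x : 'cV[R]_n)
    (X : 'M[R]_n) (i j : 'I_n) :
  rlt_feasible (x, X) ->
  [/\ 0 <= X i j, 0 <= 1 - x i 0 - x j 0 + X i j & 0 <= x j 0 - X i j].
Proof.
case=> /= /symmetricmxP sX _ bX.
have {bX} : Num.max (x i 0 + x j 0 - 1) 0 <= X i j <= Num.min (x i 0) (x j 0).
  by case: (leqP i j) => [/bX //|/ltnW/bX]; rewrite sX [x j 0 + _]addrC minC.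
rewrite ge_max le_min => /andP[/andP[h1 h2] /andP[h3 h4]].
by split; lra.
Qed.

Lemma sdprlt_feasible_lift (R : realType) (n : nat) (x : 'cV[R]_n) :
  box x -> sdprlt_feasible (x, x *m x^T).
Proof.
move=> bx; have XE i j : (x *m x^T) i j = x i 0 * x j 0.
  by rewrite mxE big_ord1 mxE.
split; last by move=> z; rewrite /= subrr mulmx0 mul0mx mxE.
split=> //= [|i j _]; first by apply/symmetricmxP => i j; rewrite !XE mulrC.
have /andP[xi0 xi1] := bx i; have /andP[xj0 xj1] := bx j.
by rewrite XE ge_max le_min; apply/andP; split; apply/andP; split; nra.
Qed.

Lemma lifted_obj_lift (R : realType) (n : nat) (Q : 'M[R]_n) (c x : 'cV[R]_n) :
  Q^T = Q -> lifted_obj Q c (x, x *m x^T) = boxqp_obj Q c x.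
Proof.
move=> sQ; rewrite /lifted_obj /boxqp_obj /mxinner /= sQ mulmxA mxtrace_mulC.
by rewrite mulmxA trace_mx11.
Qed.

(** The amount subtracted is the largest possible: the slack of
  [max (2 x_k - 1) 0 <= X_kk] at [X_kk = x_k^2] is the minimum of
  [x_k^2 - 0] and [x_k^2 - (2 x_k - 1) = (1 - x_k)^2]. It is positive
  exactly when [x_k] is fractional. *)
Lemma rlt_feasible_lower_diag (R : realType) (n : nat) (x : 'cV[R]_n)
    (k : 'I_n) :
  box x ->
  rlt_feasible
    (x, x *m x^T
        - Num.min (x k 0 ^+ 2) ((1 - x k 0) ^+ 2) *: delta_mx k k).
Proof.
move=> bx; set t := Num.min _ _.
have [[/symmetricmxP sX _ bX] _] := sdprlt_feasible_lift bx.
have t0 : 0 <= t by rewrite le_min !sqr_ge0.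
split=> //= [|i j ij].
  apply/symmetricmxP => i j; have := sX i j; rewrite /= !mxE => ->.
  by rewrite andbC.
have := bX i j ij; rewrite /= => /andP[lb ub].
have -> : (x *m x^T - t *: delta_mx k k) i j
    = (x *m x^T) i j - t * ((i == k) && (j == k))%:R by rewrite !mxE.
have [/andP[/eqP -> /eqP ->]|_] := boolP ((i == k) && (j == k)); last first.
  by rewrite mulr0 subr0 lb ub.
have tl : t <= x k 0 ^+ 2 by rewrite ge_min lexx.
have tr : t <= (1 - x k 0) ^+ 2 by rewrite ge_min lexx orbT.
have /andP[xk0 xk1] := bx k.
rewrite mxE big_ord1 mxE mulr1 ge_max le_min.
by apply/andP; split; apply/andP; split; nra.
Qed.

Lemma lifted_obj_diag (R : realType) (n : nat) (Q : 'M[R]_n) (c x : 'cV[R]_n)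
    (X : 'M[R]_n) (k : 'I_n) (t : R) :
  lifted_obj Q c (x, X - t *: delta_mx k k)
  = lifted_obj Q c (x, X) - 2^-1 * (t * Q k k).
Proof.
suff trQ : \tr (Q^T *m delta_mx k k) = Q k k.
  rewrite /lifted_obj /mxinner /= mulmxBr -scalemxAr linearB linearZ /= trQ.
  by ring.
rewrite -(mul_delta_mx (0 : 'I_1)) mulmxA mxtrace_mulC trace_mx11.
by rewrite -colE -rowE !mxE.
Qed.

(** * The dual certificate *)

Section certificate.
Variables (R : realType) (n : nat) (xhat : 'cV[R]_n).
Variables (u v : 'cV[R]_n) (W Y Z H : 'M[R]_n).

(** In the term of [H], adding [(x - xhat) (x - xhat)^T] to the slack
  [X - x x^T] combines in one matrix the two sources of suboptimality: an
  inexact lift, and a point [x] away from the minimizer [xhat] of the convex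
  quadratic part [1/2 x^T H x - xhat^T H x]. *)
Definition dual_gap (xX : 'cV[R]_n * 'M[R]_n) : R :=
  let: (x, X) := xX in
  2^-1 * (\sum_i \sum_j W i j * (1 - x i 0 - x j 0 + X i j))
  + \sum_i \sum_j Y i j * (x j 0 - X i j)
  + 2^-1 * (\sum_i \sum_j Z i j * X i j)
  + 2^-1 * mxinner H (X - x *m x^T + (x - xhat) *m (x - xhat)^T)
  + \sum_i u i 0 * (1 - x i 0) + \sum_i v i 0 * x i 0.

(** The value of the relaxed objective at [(xhat, xhat xhat^T)], once
  complementary slackness holds. *)
Definition dual_value : R :=
  - (2^-1 * (\sum_i \sum_j W i j)) - \sum_i u i 0
  - 2^-1 * mxinner H (xhat *m xhat^T).

(** Both sides are affine in [(x, X)], as [x x^T] cancels in the term of [H];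
  the symmetry of [W], [H] and [X] is what merges [sum W_ij x_i]
  with [sum W_ij x_j], the two cross terms of [H], and the contributions of
  [Y] and [Y^T]. *)
Lemma lifted_obj_dual_gap (x : 'cV[R]_n) (X : 'M[R]_n) :
  W^T = W -> H^T = H -> X^T = X ->
  lifted_obj (W - Y - Y^T + Z + H)
    (- u + v - W *m ones R n + Y^T *m ones R n - H *m xhat) (x, X)
  = dual_value + dual_gap (x, X).
Proof.
move=> sW sH sX.
pose dbl (F : 'I_n -> 'I_n -> R) := \sum_i \sum_j F i j.
have dblD F G : dbl (fun i j => F i j + G i j) = dbl F + dbl G.
  by rewrite -big_split /=; apply: eq_bigr => i _; rewrite big_split.
have dblN F : dbl (fun i j => - F i j) = - dbl F.
  by rewrite -sumrN; apply: eq_bigr => i _; rewrite sumrN.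
have dblC F : dbl (fun i j => F j i) = dbl F by rewrite /dbl exchange_big.
have dbl_eq F G : (forall i j, F i j = G i j) -> dbl F = dbl G.
  by move=> FG; apply: eq_bigr => i _; apply: eq_bigr => j _.
have WE i j : W j i = W i j by rewrite -{2}sW mxE.
have HE i j : H j i = H i j by rewrite -{2}sH mxE.
have XE i j : X j i = X i j by rewrite -{2}sX mxE.
have lQ : mxinner (W - Y - Y^T + Z + H) X
    = dbl (fun i j => W i j * X i j) - 2 * dbl (fun i j => Y i j * X i j)
      + dbl (fun i j => Z i j * X i j) + dbl (fun i j => H i j * X i j).
  have -> : 2 * dbl (fun i j => Y i j * X i j)
      = dbl (fun i j => Y i j * X i j) + dbl (fun i j => Y j i * X i j).
    rewrite mulr2n mulrDl mul1r; congr (_ + _).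
    by rewrite -dblC; apply: dbl_eq => i j; rewrite XE.
  rewrite mxinnerE opprD addrA -!dblN -!dblD; apply: dbl_eq => i j.
  by rewrite !mxE; ring.
have lc : ((- u + v - W *m ones R n + Y^T *m ones R n - H *m xhat)^T *m x) 0 0
    = - (\sum_i u i 0 * x i 0) + \sum_i v i 0 * x i 0
      - dbl (fun i j => W i j * x j 0) + dbl (fun i j => Y i j * x j 0)
      - dbl (fun i j => H i j * (xhat i 0 * x j 0)).
  rewrite mxE -(dblC (fun i j => W i j * _)) -(dblC (fun i j => Y i j * _)).
  rewrite -(dblC (fun i j => H i j * _)) -!sumrN -!big_split /=.
  apply: eq_bigr => j _; rewrite !mxE !mulrDl !mulNr !mulr_suml.
  congr (_ + _ - _ + _ - _); apply: eq_bigr => i _.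
  - by rewrite !mxE mulr1 WE.
  - by rewrite !mxE mulr1.
  - by rewrite HE mulrA.
have gW : \sum_i \sum_j W i j * (1 - x i 0 - x j 0 + X i j)
    = dbl W - 2 * dbl (fun i j => W i j * x j 0)
      + dbl (fun i j => W i j * X i j).
  have -> : 2 * dbl (fun i j => W i j * x j 0)
      = dbl (fun i j => W i j * x i 0) + dbl (fun i j => W i j * x j 0).
    rewrite mulr2n mulrDl mul1r; congr (_ + _).
    by rewrite -dblC; apply: dbl_eq => i j; rewrite WE.
  rewrite opprD addrA -!dblN -!dblD; apply: dbl_eq => i j; ring.
have gY : \sum_i \sum_j Y i j * (x j 0 - X i j)
    = dbl (fun i j => Y i j * x j 0) - dbl (fun i j => Y i j * X i j).
  by rewrite -!dblN -!dblD; apply: dbl_eq => i j; ring.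
have gu : \sum_i u i 0 * (1 - x i 0) = \sum_i u i 0 - \sum_i u i 0 * x i 0.
  by rewrite -sumrN -big_split /=; apply: eq_bigr => i _; ring.
have gH : mxinner H (X - x *m x^T + (x - xhat) *m (x - xhat)^T)
    = dbl (fun i j => H i j * X i j)
      - 2 * dbl (fun i j => H i j * (xhat i 0 * x j 0))
      + mxinner H (xhat *m xhat^T).
  have -> : 2 * dbl (fun i j => H i j * (xhat i 0 * x j 0))
      = dbl (fun i j => H i j * (xhat j 0 * x i 0))
        + dbl (fun i j => H i j * (xhat i 0 * x j 0)).
    rewrite mulr2n mulrDl mul1r; congr (_ + _).
    by rewrite -dblC; apply: dbl_eq => i j; rewrite HE.
  rewrite !mxinnerE opprD addrA -!dblN -!dblD; apply: dbl_eq => i j.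
  by rewrite !mxE !big_ord1 !mxE; ring.
rewrite /lifted_obj /dual_gap /dual_value lc gW gY gu gH /= lQ.
rewrite -/(dbl W) -/(dbl (fun i j => Z i j * X i j)).
by field.
Qed.

Lemma dual_gap_ge0 (xX : 'cV[R]_n * 'M[R]_n) :
  (forall i, 0 <= u i 0) -> (forall i, 0 <= v i 0) ->
  (forall i j, 0 <= W i j) -> (forall i j, 0 <= Y i j) ->
  (forall i j, 0 <= Z i j) -> H^T = H -> posdefmx H ->
  sdprlt_feasible xX -> 0 <= dual_gap xX.
Proof.
case: xX => x X u0 v0 W0 Y0 Z0 sH pH [fX pX].
have bnd i j := rlt_feasible_bounds i j fX.
have [_ bx _] := fX.
have ge0 (F G : 'I_n -> 'I_n -> R) : (forall i j, 0 <= F i j) ->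
    (forall i j, 0 <= G i j) -> 0 <= \sum_i \sum_j F i j * G i j.
  by move=> F0 G0; do 2!apply: sumr_ge0 => ? _; exact: mulr_ge0.
have half_ge0 (r : R) : 0 <= r -> 0 <= 2^-1 * r.
  by move=> r0; rewrite mulr_ge0 // invr_ge0 ler0n.
rewrite /dual_gap; do !apply: addr_ge0.
- by apply/half_ge0/ge0 => // i j; have [] := bnd i j.
- by apply: ge0 => // i j; have [] := bnd i j.
- by apply/half_ge0/ge0 => // i j; have [] := bnd i j.
- apply/half_ge0/mxinner_ge0 => //; apply: possemidefmxD => //.
  exact: possemidefmx_gram.
- by apply: sumr_ge0 => i _; rewrite mulr_ge0 // subr_ge0; have /andP[] := bx i.
- by apply: sumr_ge0 => i _; rewrite mulr_ge0 //; have /andP[] := bx i.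
Qed.

(** The hypotheses are the complementary slackness conditions at
  [X = xhat xhat^T], where the constraint slacks factor:
  [1 - x_i - x_j + x_i x_j = (1 - x_i) (1 - x_j)] and
  [x_j - x_i x_j = (1 - x_i) x_j]. *)
Lemma dual_gap_eq0 :
  (forall i, u i 0 * (1 - xhat i 0) = 0) -> (forall i, v i 0 * xhat i 0 = 0) ->
  (forall i j, W i j * ((1 - xhat i 0) * (1 - xhat j 0)) = 0) ->
  (forall i j, Y i j * ((1 - xhat i 0) * xhat j 0) = 0) ->
  (forall i j, Z i j * (xhat i 0 * xhat j 0) = 0) ->
  dual_gap (xhat, xhat *m xhat^T) = 0.
Proof.
move=> u0 v0 W0 Y0 Z0.
have XE i j : (xhat *m xhat^T) i j = xhat i 0 * xhat j 0.
  by rewrite mxE big_ord1 mxE.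
have dbl0 (F : 'I_n -> 'I_n -> R) :
    (forall i j, F i j = 0) -> \sum_i \sum_j F i j = 0.
  by move=> F0; do 2!apply: big1 => ? _.
rewrite /dual_gap !subrr mul0mx addr0 /mxinner mulmx0 mxtrace0.
rewrite !dbl0 => [|i j|i j|i j].
- by rewrite !big1 ?mulr0 ?addr0.
- by rewrite XE.
- by rewrite XE -(Y0 i j); ring.
- by rewrite XE -(W0 i j); ring.
Qed.

End certificate.

(** * Exactness *)

Lemma min_unique (R : realType) (A : set R) (a b : R) :
  (A `&` lbound A) a -> (A `&` lbound A) b -> a = b.
Proof.
by move=> [Aa la] [Ab lb]; apply/eqP; rewrite eq_le la // lb.
Qed.

Lemma exists_fractional (R : realType) (n : nat) (x : 'cV[R]_n) :
  (@box R n `\` @vertices R n) x -> exists k, k \in idxB x.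
Proof.
case=> bx /existsNP[k /not_orP[/eqP xk0 /eqP xk1]]; exists k.
have /andP[? ?] := bx k.
by rewrite inE !lt_neqAle eq_sym xk0 xk1; apply/and3P.
Qed.

Lemma zero_on_nneg_off_ge0 (R : realType) (n : nat) (D : {set 'I_n * 'I_n})
    (A : 'M[R]_n) :
  zero_on_nneg_off D A -> forall i j, 0 <= A i j.
Proof.
move=> hA i j; have [A0 Age0] := hA i j.
by have [/A0 -> //|/Age0] := boolP ((i, j) \in D).
Qed.

Theorem proposition5p3 (R : realType) (n : nat) (hn : (0 < n)%N)
    (xhat : 'cV[R]_n) (hxhat : (@box R n `\` @vertices R n) xhat)
    (Q : 'M[R]_n) (c : 'cV[R]_n) (hQc : algorithm4_output xhat Q c) :
  (@exact_sdprlt R n `\` @exact_rlt R n) (Q, c).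
Proof.
have [bx _] := hxhat; have [k kB] := exists_fractional hxhat.
case: hQc => u [v] [W] [Y] [Z] [H] [[hu hv [sW hW] hY [sZ hZ]]] [sH pH QE cE].
move/symmetric_trmx: sW => sW; move/symmetric_trmx: sZ => sZ.
move/symmetric_trmx: sH => sH.
have LBU i : [|| i \in idxL xhat, i \in idxB xhat | i \in idxU xhat].
  have /andP[x0 x1] := bx i.
  rewrite !inE !lt_neqAle x0 x1 !andbT [0 == _]eq_sym.
  by case: (xhat i 0 == 0); case: (xhat i 0 == 1).
have notLB i : i \notin (idxB xhat :|: idxL xhat)%SET -> i \in idxU xhat.
  rewrite finset.in_setU negb_or => /andP[/negPf iB /negPf iL].
  by have := LBU i; rewrite iB iL.
have notBU i : i \notin (idxB xhat :|: idxU xhat)%SET -> i \in idxL xhat.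
  rewrite finset.in_setU negb_or => /andP[/negPf iB /negPf iU].
  by have := LBU i; rewrite iB iU !orbF.
have L0 i : i \in idxL xhat -> xhat i 0 = 0 by rewrite inE => /eqP.
have U1 i : i \in idxU xhat -> 1 - xhat i 0 = 0.
  by rewrite inE => /eqP ->; rewrite subrr.
(* the four rectangles where Y vanishes form one rectangle *)
have {}hY : zero_on_nneg_off
    (finset.setX (idxB xhat :|: idxL xhat)%SET (idxB xhat :|: idxU xhat)%SET) Y.
  congr (zero_on_nneg_off _ Y): hY; apply/finset.setP => -[i j].
  rewrite !(finset.in_setU, finset.in_setX).
  by case: (i \in idxL xhat); case: (i \in idxB xhat);
     case: (j \in idxB xhat); case: (j \in idxU xhat).
have u0 i : 0 <= u i 0.
  have [p z] := hu i.
  have [/z ->//|] := boolP (i \in (idxL xhat :|: idxB xhat)%SET).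
  by rewrite finset.setUC => /notLB.
have v0 i : 0 <= v i 0.
  have [p z] := hv i.
  by have [/z ->//|/notBU] := boolP (i \in (idxB xhat :|: idxU xhat)%SET).
have W0 := zero_on_nneg_off_ge0 hW; have Y0 := zero_on_nneg_off_ge0 hY.
have Z0 := zero_on_nneg_off_ge0 hZ.
have sQ : Q^T = Q.
  rewrite QE !(linearD, linearN) /= trmxK sW sZ sH.
  by rewrite [W - Y^T - Y]addrAC.
have sQ' : Q \is symmetricmx.
  by apply/symmetricmxP => i j; rewrite -{1}sQ mxE.
pose gap := dual_gap xhat u v W Y Z H.
pose mu := dual_value xhat u W H.
have objE x X : X^T = X -> lifted_obj Q c (x, X) = mu + gap (x, X).
  by move=> sX; rewrite QE cE; exact: lifted_obj_dual_gap.
have objge xX : sdprlt_feasible xX -> mu <= lifted_obj Q c xX.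
  case: xX => x X fX; have [[/symmetric_trmx sX _ _] _] := fX.
  by rewrite objE // lerDl; exact: dual_gap_ge0.
(* off each zero rectangle, one index lies in the set that makes the
   corresponding slack vanish *)
have obj_xhat : lifted_obj Q c (xhat, xhat *m xhat^T) = mu.
  rewrite objE; last by rewrite trmx_mul trmxK.
  rewrite /gap dual_gap_eq0 ?addr0 // => [i|i|i j|i j|i j].
  - have [_ z] := hu i.
    have [/z ->|] := boolP (i \in (idxL xhat :|: idxB xhat)%SET).
      exact: mul0r.
    by rewrite finset.setUC => /notLB/U1 ->; rewrite mulr0.
  - have [_ z] := hv i.
    have [/z ->|/notBU/L0 ->] := boolP (i \in (idxB xhat :|: idxU xhat)%SET).
      exact: mul0r.
    exact: mulr0.
  - have [z _] := hW i j.
    case: (boolP ((i, j) \in _)) z => [_ -> //|]; first by rewrite mul0r.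
    rewrite finset.in_setX negb_and => /orP[] /notLB/U1 ->;
      by rewrite ?(mul0r, mulr0).
  - have [z _] := hY i j.
    case: (boolP ((i, j) \in _)) z => [_ -> //|]; first by rewrite mul0r.
    rewrite finset.in_setX negb_and => /orP[/notLB/U1|/notBU/L0] ->;
      by rewrite ?(mul0r, mulr0).
  - have [z _] := hZ i j.
    case: (boolP ((i, j) \in _)) z => [_ -> //|]; first by rewrite mul0r.
    rewrite finset.in_setX negb_and => /orP[] /notBU/L0 ->;
      by rewrite ?(mul0r, mulr0).
have minQP : boxqp_min Q c = mu.
  apply: min_unique (boxqp_min_attained Q c) _; split.
    by exists xhat; rewrite // -lifted_obj_lift.
  move=> _ [y byy <-]; rewrite -lifted_obj_lift //.
  exact/objge/sdprlt_feasible_lift.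
have minRS : sdprlt_min Q c = mu.
  apply: min_unique (sdprlt_min_attained Q c) _; split.
    by exists (xhat, xhat *m xhat^T) => //; exact: sdprlt_feasible_lift.
  by move=> _ [xX fX <-]; exact: objge.
split; first by split=> //=; rewrite minQP minRS.
case=> _ /=; rewrite minQP => rltE.
have [_ lb] := rlt_min_attained Q c.
have := lb _ (imageP _ (rlt_feasible_lower_diag k bx)).
rewrite -rltE lifted_obj_diag obj_xhat => /=.
apply/negP; rewrite -ltNge ltrBlDr ltrDl.
have Qkk : Q k k = H k k.
  have [Wkk _] := hW k k; have [Ykk _] := hY k k; have [Zkk _] := hZ k k.
  rewrite QE !mxE Wkk ?Ykk ?Zkk ?finset.in_setX ?finset.in_setU ?kB ?orbT //.
  by ring.
move: kB; rewrite inE => /andP[xk0 xk1].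
rewrite Qkk; apply: mulr_gt0; first by rewrite invr_gt0 ltr0n.
apply: mulr_gt0; last exact: posdefmx_diag_gt0.
by rewrite lt_min !exprn_gt0 // subr_gt0.
Qed.
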